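(* Let $V$ be a $3$-dimensional vector space over $\mathbb{F}_4$ with a non-degenerate hermitian form $h$, let $s(x,y)=h(x,y)+h(y,x)$, and let $V_1=\{x\in V\mid h(x,x)=1\}$ (a set of $36$ vectors). Let $H_0$ be a hyperoval of $\mathrm{PG}(V)$ all of whose points are non-isotropic, and let $W=\{x\in V_1\mid [x]\in H_0\}$. Let $\Gamma$ be the graph with vertex-set $V_1$ in which two distinct vertices $u,v$ are adjacent if and only if $s(u,v)=0$, and let $\Gamma'$ be the graph obtained by switching $\Gamma$ with respect to $W$. Then the automorphism group of $\Gamma'$ satisfies $\mathrm{Aut}\,\Gamma'\simeq G_2(2)$.
   Context: Write $\mathbb{F}_4=\{0,1,\omega,\bar\omega\}$, with $\bar a=a^2$. A hermitian form $h$ on $V$ is linear in one variable and semilinear (with respect to $a\mapsto\bar a$) in the other, with $h(y,x)=\overline{h(x,y)}$. $\mathrm{PG}(V)$ is the projective plane of order $4$ whose points are the $1$-dimensional subspaces $[x]$ of $V$ ($x\neq 0$); the point $[x]$ is non-isotropic if $h(x,x)\neq 0$ (then $h(x,x)=1$). There are $12$ non-isotropic points. A hyperoval is a set of $6$ points, no three collinear. $\tilde H_0$ denotes the set of the remaining $6$ non-isotropic points, and $\tilde W=\{x\in V_1\mid [x]\in\tilde H_0\}$, so that $V_1$ is the disjoint union of $W$ and $\tilde W$, each consisting of $18$ vectors. Graphs are finite, simple and undirected. Switching a graph with respect to a subset $Y$ of its vertices means interchanging edges and non-edges between $Y$ and its complement, leaving adjacency inside $Y$ and inside the complement unchanged.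 $G_2(2)$ is the Chevalley group of type $G_2$ over $\mathbb{F}_2$ (the full group, of order $12096$), which is isomorphic to $U_3(3){:}2$, where $U_3(3)=\mathrm{PSU}_3(3)$. *)

(* Defs.v *)
From HB Require Import structures.
From mathcomp Require Import all_boot all_order all_fingroup all_algebra all_field.
From mathcomp Require Import sesquilinear finmap ring.

Set Implicit Arguments.
Unset Strict Implicit.
Unset Printing Implicit Defensive.

Import GroupScope GRing.Theory.
Local Open Scope ring_scope.

Section Graphs.
Variable T : finType.

Definition simple_graph (e : rel T) := symmetric e /\ irreflexive e.

Definition switch (Y : {set T}) (e : rel T) : rel T :=
  [rel u v | e u v (+) ((u \in Y) (+) (v \in Y))].

Lemma switch_simple Y e : simple_graph e -> simple_graph (switch Y e).
Proof.
move=> [sym_e irr_e]; split=> [u v | u]; rewrite /switch /=; last first.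
  by rewrite irr_e addbb.
by rewrite sym_e (addbC (u \in Y)).
Qed.

Definition graph_aut (e : rel T) : {set {perm T}} :=
  [set p : {perm T} | [forall u, forall v, e (p u) (p v) == e u v]].

Lemma graph_autP e (p : {perm T}) :
  reflect (forall u v, e (p u) (p v) = e u v) (p \in graph_aut e).
Proof.
rewrite inE; apply: (iffP forallP) => [h u v | h u].
  by have /forallP/(_ v)/eqP := h u.
by apply/forallP=> v; rewrite h.
Qed.

Lemma graph_aut_group_set e : group_set (graph_aut e).
Proof.
apply/group_setP; split=> [|p q /graph_autP hp /graph_autP hq].
  by apply/graph_autP=> u v; rewrite !perm1.
by apply/graph_autP=> u v; rewrite !permM hq hp.
Qed.

Canonical graph_aut_group e := Group (graph_aut_group_set e).

End Graphs.

Section ProjectiveGeometry.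
Variables (F : finFieldType) (V : vectType F).

Definition collinear (P Q R : {vspace V}) :=
  exists L : {vspace V}, [/\ \dim L = 2%N, (P <= L)%VS, (Q <= L)%VS & (R <= L)%VS].

(* In a projective plane of order q the size is q + 2; here q = 4. *)
Definition hyperoval (H : {fset {vspace V}}) :=
  [/\ #|` H|%fset = 6%N,
      forall P, P \in H -> \dim P = 1%N &
      forall P Q R, P \in H -> Q \in H -> R \in H ->
        P != Q -> P != R -> Q != R -> ~ collinear P Q R].

End ProjectiveGeometry.

Section HermitianGraph.
Variables (F : finFieldType) (theta : {rmorphism F -> F}) (V : vectType F).
Variable h : {hermitian V for false & theta}.

(* V_1; finvect_type V is V itself, seen as a finite type. *)
Definition unit_vector := {x : finvect_type V | h x x == 1}.

Definition trace_form (x y : V) : F := h x y + h y x.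

Definition unit_graph : rel unit_vector :=
  [rel u v | (u != v) && (trace_form (sval u) (sval v) == 0)].

Lemma unit_graph_simple : simple_graph unit_graph.
Proof.
split=> [u v | u]; rewrite /unit_graph /= ?eqxx //.
by rewrite eq_sym /trace_form addrC.
Qed.

Definition vectors_over (H : {fset {vspace V}}) : {set unit_vector} :=
  [set u : unit_vector | <[sval u : V]>%VS \in H].

End HermitianGraph.

(* The adjoint Chevalley group of type G_2. Roots are written in the basis     *)
(* (short simple root, long simple root); the root i + 6 is the opposite of    *)
(* the root i, for i < 6.                                                      *)
Section ChevalleyG2.

Definition G2_roots : seq (int * int) := [::
  (1, 0); (0, 1); (1, 1); (2, 1); (3, 1); (3, 2);
  (-1, 0); (0, -1); (-1, -1); (-2, -1); (-3, -1); (-3, -2)]%Z.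

Definition G2_root (i : nat) : int * int := nth 0 G2_roots i.

Definition G2_ip (r s : int * int) : int :=
  2 * (r.1 * s.1) - 3 * (r.1 * s.2 + r.2 * s.1) + 6 * (r.2 * s.2).

(* 2 (r, s) / (r, r) *)
Definition G2_cartan (r s : int * int) : int :=
  ((2 * G2_ip r s) %/ G2_ip r r)%Z.

(* Coordinates of the coroot 2 r / (r, r) in the basis of the two simple       *)
(* coroots, whose roots have square lengths 2 and 6.                           *)
Definition G2_coroot (r : int * int) : int * int :=
  (((2 * r.1) %/ G2_ip r r)%Z, ((6 * r.2) %/ G2_ip r r)%Z).

(* The structure constants N_{r, s} of a Chevalley basis, defined by           *)
(* [e_r, e_s] = N_{r, s} e_{r + s} when r + s is a root.                       *)
Definition G2_N (i j : nat) : int := nth 0 (nth [::] [::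
  [::  0;  1;  2;  3;  0;  0;  0;  0; -3; -2; -1;  0];
  [:: -1;  0;  0;  0;  1;  0;  0;  0;  1;  0;  0; -1];
  [:: -2;  0;  0; -3;  0;  0; -3;  1;  0;  2;  0;  1];
  [:: -3;  0;  3;  0;  0;  0; -2;  0;  2;  0;  1; -1];
  [::  0; -1;  0;  0;  0;  0; -1;  0;  0;  1;  0;  1];
  [::  0;  0;  0;  0;  0;  0;  0; -1;  1; -1;  1;  0];
  [::  0;  0;  3;  2;  1;  0;  0; -1; -2; -3;  0;  0];
  [::  0;  0; -1;  0;  0;  1;  1;  0;  0;  0; -1;  0];
  [::  3; -1;  0; -2;  0; -1;  2;  0;  0;  3;  0;  0];
  [::  2;  0; -2;  0; -1;  1;  3;  0; -3;  0;  0;  0];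
  [::  1;  0;  0; -1;  0; -1;  0;  1;  0;  0;  0;  0];
  [::  0;  1; -1;  1; -1;  0;  0;  0;  0;  0;  0;  0]]%Z i) j.

(* Chevalley basis b_0, ..., b_13 of the Lie algebra of type G_2 over Z:       *)
(* b_i is the root vector of the root i for i < 12, and b_12, b_13 are the     *)
(* simple coroots. G2_bracket i j k is the coefficient of b_k in [b_i, b_j].   *)
Definition G2_bracket (i j k : nat) : int :=
  let r := G2_root i in let s := G2_root j in
  match (i < 12)%N, (j < 12)%N with
  | true, true =>
      if r + s == 0 then
        if k == 12 then (G2_coroot r).1
        else if k == 13 then (G2_coroot r).2 else 0
      else if (k < 12)%N && (G2_root k == r + s) then G2_N i j else 0
  | true, false => if k == i then - G2_cartan (G2_root (j - 12)) r else 0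
  | false, true => if k == j then G2_cartan (G2_root (i - 12)) s else 0
  | false, false => 0
  end.

(* Row j holds the coordinates of [b_i, b_j]: matrices act on row vectors.     *)
Definition G2_ad (i : nat) : 'M[int]_14 := \matrix_(j, k) G2_bracket i j k.

(* (ad b_i)^n / n!, which is integral when b_i is a root vector. *)
Definition G2_divpow (i n : nat) : 'M[int]_14 :=
  map_mx (fun z => (z %/ n`!)%Z) (G2_ad i ^+ n).

(* exp(t ad e_r) for the root r of index i; the terms of degree > 3 vanish. *)
Definition G2_x (K : finFieldType) (i : nat) (t : K) : 'M[K]_14 :=
  \sum_(n < 4) t ^+ n *: map_mx intr (G2_divpow i n).

Definition G2_generators (K : finFieldType) : {set {'GL_14[K]}} :=
  [set g : {'GL_14[K]} | [exists i : 'I_12, exists t : K, GLval g == G2_x i t]].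

Definition chevalley_G2 (K : finFieldType) : {set {'GL_14[K]}} :=
  <<G2_generators K>>.

Canonical chevalley_G2_group K := Eval hnf in [group of chevalley_G2 K].

End ChevalleyG2.

(* Checks that the table G2_N gives a Chevalley basis: Jacobi identity, the     *)
(* values +- (p + 1) and the signs N_{-r, -s} = - N_{r, s}. Moreover t |->      *)
(* x_r(t) is a morphism, so G2_generators consists of all the x_r(t).          *)
Section ChevalleyG2Facts.

Let sum14 (f : nat -> int) : int := foldr (fun k s => f k + s) 0 (iota 0 14).

Let sum14E (f : nat -> int) : \sum_(k < 14) f (nat_of_ord k) = sum14 f.
Proof. by rewrite -(big_mkord xpredT f) unlock. Qed.

Let all_iotaP n (P : pred nat) : all P (iota 0 n) -> forall i, (i < n)%N -> P i.
Proof. by move=> /allP hP i ltin; apply: hP; rewrite mem_iota. Qed.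

Lemma G2_N_abs i j : (i < 12)%N -> (j < 12)%N ->
  G2_root i + G2_root j \in G2_roots ->
  `|G2_N i j|%N =
    (count (fun n => G2_root j - G2_root i *+ n \in G2_roots) [:: 1; 2; 3]%N).+1.
Proof.
move=> hi hj.
pose P i j := (G2_root i + G2_root j \in G2_roots) ==> (`|G2_N i j|%N ==
  (count (fun n => G2_root j - G2_root i *+ n \in G2_roots) [:: 1; 2; 3]%N).+1).
suff: P i j by move=> /implyP hP /hP /eqP.
move: j hj; apply: all_iotaP; move: i hi; apply: all_iotaP.
by vm_compute.
Qed.

Lemma G2_N_opp i j : (i < 6)%N -> (j < 12)%N ->
  G2_N (i + 6) ((j + 6) %% 12) = - G2_N i j.
Proof.
move=> hi hj; apply/eqP; move: j hj; apply: all_iotaP.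
move: i hi; apply: all_iotaP; by vm_compute.
Qed.

Lemma G2_bracketC i j k : (i < 14)%N -> (j < 14)%N -> (k < 14)%N ->
  G2_bracket i j k = - G2_bracket j i k.
Proof.
move=> hi hj hk; apply/eqP; move: k hk; apply: all_iotaP.
move: j hj; apply: all_iotaP; move: i hi; apply: all_iotaP.
by vm_compute.
Qed.

(* Matrices given by the list of their rows, for computation. *)
Let entry (a : seq (seq int)) i j : int := nth 0 (nth [::] a i) j.

Let tab (f : nat -> nat -> int) : seq (seq int) :=
  [seq [seq f i j | j <- iota 0 14] | i <- iota 0 14].

Let mxl (a : seq (seq int)) : 'M[int]_14 := \matrix_(i, j) entry a i j.

Let mull a b := tab (fun i j => sum14 (fun k => entry a i k * entry b k j)).

Let powl i n :=
  iter n (mull (tab (G2_bracket i))) (tab (fun j k => ((j == k) : nat)%:Z)).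

Let divpowl i n :=
  let p := powl i n in tab (fun j k => (entry p j k %/ n`!)%Z).

Let entry_tab f i j : (i < 14)%N -> (j < 14)%N -> entry (tab f) i j = f i j.
Proof.
move=> hi hj; rewrite /entry (nth_map 0%N) ?size_iota //.
by rewrite (nth_map 0%N) ?size_iota // !nth_iota.
Qed.

Let mxl_tab f : mxl (tab f) = \matrix_(i, j) f (nat_of_ord i) (nat_of_ord j).
Proof. by apply/matrixP=> i j; rewrite !mxE entry_tab. Qed.

Let brl := [seq tab (G2_bracket i) | i <- iota 0 14].

Let brlE i j k : (i < 14)%N -> (j < 14)%N -> (k < 14)%N ->
  G2_bracket i j k = entry (nth [::] brl i) j k.
Proof.
by move=> hi hj hk; rewrite (nth_map 0%N) ?size_iota // nth_iota // entry_tab.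
Qed.

Lemma G2_jacobi i j k l :
    (i < 14)%N -> (j < 14)%N -> (k < 14)%N -> (l < 14)%N ->
  \sum_(m < 14) (G2_bracket i j m * G2_bracket m k l +
                 G2_bracket j k m * G2_bracket m i l +
                 G2_bracket k i m * G2_bracket m j l) = 0.
Proof.
move=> hi hj hk hl; under eq_bigr => m _ do rewrite !brlE //.
pose j0 (b : seq (seq (seq int))) i j k l (m : nat) :=
  let c u v w := entry (nth [::] b u) v w in
  c i j m * c m k l + c j k m * c m i l + c k i m * c m j l.
pose J b i j k l := sum14 (j0 b i j k l).
have h : let b := brl in let I := iota 0 14 in
    all (fun i => all (fun j => all (fun k => all (fun l =>
      J b i j k l == 0) I) I) I) I by vm_compute.
apply/eqP; rewrite (sum14E (j0 brl i j k l)) -/(J brl i j k l).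
move: l hl; apply: all_iotaP;
   move: k hk; apply: all_iotaP; move: j hj; apply: all_iotaP;
   move: i hi; apply: all_iotaP; exact: h.
Qed.

Let mxl_mul a b : mxl a *m mxl b = mxl (mull a b).
Proof.
apply/matrixP=> i j; rewrite mxl_tab !mxE -sum14E.
by apply: eq_bigr => k _; rewrite !mxE.
Qed.

Let powlE i n : G2_ad i ^+ n = mxl (powl i n).
Proof.
rewrite /powl; elim: n => [|n IHn].
  by apply/matrixP=> j k; rewrite /= mxl_tab expr0 !mxE natz.
by rewrite exprS IHn /= -mxl_mul mxl_tab.
Qed.

Let divpowlE i n : G2_divpow i n = mxl (divpowl i n).
Proof. by apply/matrixP=> j k; rewrite mxl_tab [LHS]mxE powlE !mxE. Qed.

Let mxl_eq a b : a = b -> mxl a = mxl b. Proof. by move->. Qed.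

Lemma G2_divpow_integral i n : (i < 12)%N -> (n < 4)%N ->
  n`!%:Z *: G2_divpow i n = G2_ad i ^+ n.
Proof.
move=> hi hn; rewrite divpowlE powlE.
have -> : n`!%:Z *: mxl (divpowl i n) =
    mxl (let d := divpowl i n in let c := n`!%:Z in
         tab (fun j k => c * entry d j k)).
  by apply/matrixP=> j k; rewrite mxl_tab !mxE.
apply/mxl_eq/eqP; move: n hn; apply: all_iotaP; move: i hi; apply: all_iotaP.
by vm_compute.
Qed.

Lemma G2_divpow_eq0 i n : (i < 12)%N -> (3 < n)%N -> G2_divpow i n = 0.
Proof.
move=> hi hn; rewrite /G2_divpow -(subnK hn) exprD (powlE i 4).
suff -> : mxl (powl i 4) = 0.
  by rewrite mulr0; apply/matrixP=> j k; rewrite !mxE div0z.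
have -> : mxl (powl i 4) = mxl (tab (fun _ _ => 0)).
  by apply/mxl_eq/eqP; move: i hi; apply: all_iotaP; vm_compute.
by apply/matrixP=> u v; rewrite mxl_tab !mxE.
Qed.

Lemma G2_divpow_mul i n m : (i < 12)%N -> (n < 4)%N -> (m < 4)%N ->
  G2_divpow i n *m G2_divpow i m = 'C(n + m, n)%:Z *: G2_divpow i (n + m).
Proof.
move=> hi hn hm; rewrite !divpowlE mxl_mul.
have -> : 'C(n + m, n)%:Z *: mxl (divpowl i (n + m)) =
    mxl (let d := divpowl i (n + m) in let c := 'C(n + m, n)%:Z in
         tab (fun j k => c * entry d j k)).
  by apply/matrixP=> j k; rewrite mxl_tab !mxE.
apply/mxl_eq/eqP; move: m hm; apply: all_iotaP; move: n hn; apply: all_iotaP.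
move: i hi; apply: all_iotaP; by vm_compute.
Qed.

Lemma G2_x0 (K : finFieldType) i : G2_x i (0 : K) = 1.
Proof.
rewrite /G2_x big_ord_recl big1 => [|n _]; last by rewrite expr0n scale0r.
rewrite addr0 expr0 scale1r /G2_divpow expr0.
by apply/matrixP=> j k; rewrite !mxE divz1; case: (j == k).
Qed.

Lemma G2_xD (K : finFieldType) i (t u : K) : (i < 12)%N ->
  G2_x i t *m G2_x i u = G2_x i (t + u).
Proof.
move=> hi; pose A n : 'M[K]_14 := map_mx intr (G2_divpow i n).
have AM n m : (n < 4)%N -> (m < 4)%N ->
    A n *m A m = 'C(n + m, n)%:R *: A (n + m)%N.
  move=> hn hm; rewrite /A -map_mxM G2_divpow_mul //.
  by apply/matrixP=> j k; rewrite !mxE rmorphM /= .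
have A0 n : (3 < n)%N -> A n = 0.
  by move=> hn; rewrite /A G2_divpow_eq0 // map_mx0.
have A00 : A 0%N = 1%:M.
  by apply/matrixP=> j k; rewrite /A /G2_divpow expr0 !mxE divz1; case: (j == k).
have xE v : G2_x i v = 1%:M + v *: A 1%N + v ^+ 2 *: A 2%N + v ^+ 3 *: A 3%N.
  by rewrite /G2_x !big_ord_recr big_ord0 /= add0r -A00 expr0 scale1r expr1.
have A11 : A 1%N *m A 1%N = 2%:R *: A 2%N by exact: (AM 1%N 1%N).
have A12 : A 1%N *m A 2%N = 3%:R *: A 3%N by exact: (AM 1%N 2%N).
have A21 : A 2%N *m A 1%N = 3%:R *: A 3%N by exact: (AM 2%N 1%N).
have Az n m : (n < 4)%N -> (m < 4)%N -> (3 < n + m)%N -> A n *m A m = 0.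
  by move=> hn hm hnm; rewrite AM // A0 // scaler0.
rewrite !xE !mulmxDl !mulmxDr !mul1mx !mulmx1 -!scalemxAl -!scalemxAr.
rewrite A11 A12 A21 !Az // !scaler0 !addr0.
by apply/matrixP=> j k; rewrite !mxE; ring.
Qed.

Lemma G2_x_unit (K : finFieldType) i (t : K) : (i < 12)%N -> G2_x i t \in unitmx.
Proof.
by move=> hi; have /mulmx1_unit[] : G2_x i t *m G2_x i (- t) = 1%:M
  by rewrite G2_xD // subrr G2_x0.
Qed.

End ChevalleyG2Facts.

(* Main.v *)
Require Import Defs.
From mathcomp Require Import all_boot all_order all_fingroup all_algebra all_field.
From mathcomp Require Import sesquilinear finmap ring.

Set Implicit Arguments.
Unset Strict Implicit.
Unset Printing Implicit Defensive.

Import GroupScope GRing.Theory.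
Local Open Scope ring_scope.

(** Both groups act on the same 36 objects.

    In the Lie algebra of type G_2 over F_2, of dimension 14, the long roots
    form a subsystem of type A_2.  The subalgebra sl_3 that it defines
    contains 21 long root vectors and has 36 conjugates under G_2(2).  Two
    distinct conjugates share 5 or 9 long root vectors, and the sum of the
    shared ones is a long root vector in the first case and 0 in the second.
    This sum, [common_sum u v], is therefore a function on pairs of conjugates
    with values in F_2^14 that commutes with G_2(2).  Let [A2_graph] join two
    conjugates when the value is not 0.

    A permutation p of the 36 conjugates and a matrix g are compatible when
    common_sum (p u) (p v) = common_sum u v * g for all u and v.  The values
    of [common_sum] span F_2^14, so p determines g; the rows of the table of
    [common_sum] are distinct as sets, so g determines p.  The pairs formed by
    a root element and its action on the conjugates are compatible, so they
    generate a group of pairs that is isomorphic to each of its two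
    projections ([isog_gen_of_pairs]).  One projection is the Chevalley group.
    The other is the whole automorphism group of [A2_graph]
    ([graph_aut_A2]): sifting through a chain of stabilizers, with orbits of
    lengths 36, 14, 4 and 6, reduces any automorphism to one that fixes enough
    vertices to be the identity.

    It remains to recognise the switched graph.  Let P be a point of H0.  The
    other five points of H0 lie on different lines through P, so each of the
    five lines through P contains exactly one of them.  Two of these lines
    join P to a point Q orthogonal to P and contain only the non-isotropic
    points P and Q, so Q is in H0.  Hence H0 is the union of two orthonormal
    frames, and after rescaling one vector of the first frame it consists of
    the coordinate points and of the points (x, y, z) with xyz = 1
    ([exists_adapted_frame]).  All data are then explicit over F_4, and a
    suitable numbering of the conjugates identifies the 36 unit vectors with
    them, carrying the switched graph to [A2_graph]
    ([switched_graph_isog]). *)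

(** * Isomorphisms between automorphism groups and generated groups *)

Lemma graph_aut_isog (T1 T2 : finType) (e1 : rel T1) (e2 : rel T2)
    (f : T1 -> T2) :
    injective f -> (forall y, exists x, f x = y) ->
    (forall u v, e2 (f u) (f v) = e1 u v) ->
  graph_aut e1 \isog graph_aut e2.
Proof.
move=> inj_f surj_f fe.
have [g fK gK] : bijective f.
  apply: inj_card_bij => //; rewrite -(card_codom inj_f).
  by apply/subset_leq_card/subsetP => y _; have [x <-] := surj_f y; apply: codom_f.
have inj_tr (p : {perm T1}) : injective (f \o p \o g).
  by apply: inj_comp; [apply: inj_comp => //; apply: perm_inj | apply: can_inj gK].
pose tr p := perm (inj_tr p).
have trM : {in graph_aut e1 &, {morph tr : p q / (p * q)%g}}.
  by move=> p q _ _; apply/permP=> y; rewrite permM !permE /= !permE /= fK.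
pose tr_morph := Morphism trM.
have inj_tr_morph : ('injm tr_morph)%g.
  apply/injmP=> p q _ _ /permP eq_pq; apply/permP=> x; apply: inj_f.
  by have := eq_pq (f x); rewrite !permE /= fK.
suff im_tr : (tr_morph @* graph_aut e1)%g = graph_aut e2.
  by rewrite -im_tr; apply: sub_isog.
apply/setP=> q; rewrite morphimEdom; apply/imsetP/graph_autP.
  case=> p aut_p -> u v.
  by have /graph_autP pe := aut_p; rewrite -[u]gK -[v]gK !permE /= !fK !fe pe.
move=> aut_q.
have inj_q : injective (g \o q \o f).
  by apply: inj_comp; [apply: inj_comp; [apply: can_inj gK | apply: perm_inj] | ].
exists (perm inj_q).
  by apply/graph_autP=> u v; rewrite !permE /= -fe !gK aut_q fe.
by apply/permP=> y; rewrite !permE /= !permE /= !gK.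
Qed.

(** A version of the lemma of Goursat: the group generated by the pairs (a i, b
    i) lies in E, on which both projections are injective, so it is
    isomorphic to both of its projections. *)
Lemma isog_gen_of_pairs (aT bT : finGroupType) (I : finType)
    (a : I -> aT) (b : I -> bT) (E : {group aT * bT}) :
    (forall i, (a i, b i) \in E) ->
    (forall y, (1%g, y) \in E -> y = 1%g) ->
    (forall x, (x, 1%g) \in E -> x = 1%g) ->
  <<[set a i | i : I]>>%g \isog <<[set b i | i : I]>>%g.
Proof.
move=> abE E1y Ex1; pose S := [set (a i, b i) | i : I].
have sSE : <<S>>%g \subset E.
  by rewrite gen_subG; apply/subsetP=> _ /imsetP[i _ ->].
pose f := restrm (subsetT E) [morphism of (@fst aT bT)].
pose g := restrm (subsetT E) [morphism of (@snd aT bT)].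
have inj_f : ('injm f)%g.
  apply/subsetP=> -[x y]; rewrite !inE /= => /andP[Exy /eqP x1].
  have {}x1 : x = 1%g := x1; rewrite x1 in Exy *.
  by rewrite (E1y _ Exy).
have inj_g : ('injm g)%g.
  apply/subsetP=> -[x y]; rewrite !inE /= => /andP[Exy /eqP y1].
  have {}y1 : y = 1%g := y1; rewrite y1 in Exy *.
  by rewrite (Ex1 _ Exy).
have im_f : (f @* <<S>> = <<[set a i | i : I]>>)%g.
  rewrite morphim_restrm (setIidPr sSE) morphim_gen ?subsetT //.
  by rewrite morphimEsub ?subsetT // -imset_comp.
have im_g : (g @* <<S>> = <<[set b i | i : I]>>)%g.
  rewrite morphim_restrm (setIidPr sSE) morphim_gen ?subsetT //.
  by rewrite morphimEsub ?subsetT // -imset_comp.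
have := sub_isog sSE inj_f; rewrite im_f isog_sym => /isog_trans; apply.
by have := sub_isog sSE inj_g; rewrite im_g.
Qed.

(** * Matrices given by lists of rows *)

Lemma all_iotaP n (P : pred nat) :
  all P (iota 0 n) -> forall i, (i < n)%N -> P i.
Proof. by move=> /allP allP i ltin; apply: allP; rewrite mem_iota. Qed.

Lemma big_ord_foldr (T : Type) (op : T -> T -> T) (x0 : T) n (F : nat -> T) :
  \big[op/x0]_(i < n) F i = foldr (fun i => op (F i)) x0 (iota 0 n).
Proof. by rewrite -(big_mkord xpredT F) /index_iota subn0 unlock. Qed.

Section SeqMatrix.

Definition tabulate (T : Type) m n (f : nat -> nat -> T) : seq (seq T) :=
  [seq [seq f i j | j <- iota 0 n] | i <- iota 0 m].

Definition entry (T : Type) (x0 : T) (a : seq (seq T)) i j : T :=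
  nth x0 (nth [::] a i) j.

Lemma entry_tabulate (T : Type) (x0 : T) m n f i j :
  (i < m)%N -> (j < n)%N -> entry x0 (tabulate m n f) i j = f i j.
Proof.
move=> ltim ltjn; rewrite /entry (nth_map 0%N) ?size_iota //.
by rewrite (nth_map 0%N) ?size_iota // !nth_iota.
Qed.

Lemma size_tabulate (T : Type) m n (f : nat -> nat -> T) :
  size (tabulate m n f) = m.
Proof. by rewrite size_map size_iota. Qed.

Variable R : nzRingType.

Fixpoint seq_add (r s : seq R) : seq R :=
  match r, s with
  | x :: r', y :: s' => (x + y) :: seq_add r' s'
  | [::], _ => s
  | _, [::] => r
  end.

Lemma nth_seq_add r s j : (seq_add r s)`_j = r`_j + s`_j.
Proof.
by elim: r s j => [|x r IHr] [|y s] [|j] //=; rewrite ?add0r ?addr0.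
Qed.

Variable n : nat.

(** The product of a row by a matrix. Starting from n zeros makes the result a
    list of length n whenever the rows have length n, even if all
    coefficients vanish, so that vectors can be compared as lists. Skipping
    the zero coefficients matters because the matrices below are sparse. *)
Fixpoint seq_row_mul (v : seq R) (a : seq (seq R)) : seq R :=
  match v, a with
  | x :: v', r :: a' =>
      if x == 0 then seq_row_mul v' a'
      else seq_add [seq x * y | y <- r] (seq_row_mul v' a')
  | _, _ => nseq n 0
  end.

Lemma nth_seq_row_mul v a m j : (size a <= m)%N ->
  (seq_row_mul v a)`_j = \sum_(i < m) v`_i * entry 0 a i j.
Proof.
have nil0 i : ([::] : seq R)`_i = 0 by rewrite nth_nil.
elim: v a m => [|x v IHv] [|r a] m le_am /=.
1-3: rewrite nth_nseq if_same big1 // => i _.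
1-3: by rewrite /entry ?nil0 ?mul0r // nth_nil nil0 mulr0.
case: m le_am => // m le_am; rewrite big_ord_recl /= {1}/entry /=.
have [->|_] := eqVneq x 0; first by rewrite mul0r add0r -IHv.
rewrite nth_seq_add -IHv //; congr (_ + _).
have [ltj|lej] := ltnP j (size r); first by rewrite (nth_map 0).
by rewrite !nth_default ?size_map ?mulr0.
Qed.

Definition seq_mul (a b : seq (seq R)) := [seq seq_row_mul v b | v <- a].

Definition seq_mx p q (a : seq (seq R)) : 'M[R]_(p, q) :=
  \matrix_(i, j) entry 0 a i j.

Lemma seq_mx_mul p m q a b : size a = p -> size b = m ->
  seq_mx p q (seq_mul a b) = seq_mx p m a *m seq_mx m q b.
Proof.
move=> sz_a sz_b; apply/matrixP=> i j; rewrite !mxE /entry.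
rewrite (nth_map [::]) ?sz_a //.
rewrite (nth_seq_row_mul _ _ (m := m)) ?sz_b //.
by apply: eq_bigr => k _; rewrite !mxE.
Qed.

End SeqMatrix.

Fixpoint all_masks n (P : pred bitseq) : bool :=
  if n is n'.+1 then
    all_masks n' (fun m => P (true :: m)) && all_masks n' (fun m => P (false :: m))
  else P [::].

Lemma all_masksP n P m : all_masks n P -> size m = n -> P m.
Proof.
elim: m n P => [|b m IHm] [|n] P //= /andP[Pt Pf] [sz_m].
by case: b; [apply: IHm Pt _ | apply: IHm Pf _].
Qed.

(** * Root elements of the adjoint group of type G_2 over F_2 *)

Arguments seq_mul : simpl never.

Definition ad_seq i : seq (seq int) := tabulate 14 14 (G2_bracket i).

Definition ad_pow i n : seq (seq int) :=
  iter n (seq_mul 14 (ad_seq i)) (tabulate 14 14 (fun j k => (j == k)%:Z)).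

Lemma seq_mx_tabulate (R : nzRingType) m n (f : nat -> nat -> R) :
  seq_mx m n (tabulate m n f) = \matrix_(i, j) f i j.
Proof. by apply/matrixP=> i j; rewrite !mxE entry_tabulate. Qed.

Lemma size_ad_pow i n : size (ad_pow i n) = 14.
Proof. by case: n => [|n]; rewrite ?size_tabulate //= size_map size_tabulate. Qed.

Lemma ad_powE i n : G2_ad i ^+ n = seq_mx 14 14 (ad_pow i n).
Proof.
elim: n => [|n IHn].
  by rewrite expr0 seq_mx_tabulate; apply/matrixP=> j k; rewrite !mxE natz.
rewrite exprS IHn [ad_pow i n.+1]iterS.
by rewrite (seq_mx_mul _ (m := 14)) ?size_tabulate ?size_ad_pow // seq_mx_tabulate.
Qed.

(** Vectors over F_2 are represented by lists of bits, which can be evaluated;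
    this map is the isomorphism from the ring of booleans. *)
Definition F2 (b : bool) : 'F_2 := (b : nat)%:R.

Lemma F2_int (z : int) : z%:~R = F2 (odd `|z|).
Proof.
have F2_nat m : m%:R = F2 (odd m) :> 'F_2.
  rewrite -[in LHS](odd_double_half m) natrD -mul2n natrM.
  by rewrite (pchar_Fp_0 (p := 2)) // mul0r addr0.
case: z => m; first exact: F2_nat.
by rewrite NegzE mulrNz abszN -pmulrn F2_nat absz_nat; case: odd; apply: val_inj.
Qed.

(** The matrix of G2_x k 1 modulo 2: the sum of the divided powers (ad e)^n / n!
    for n < 4. *)
Definition root_table k : seq bitseq :=
  let p := [seq ad_pow k n | n <- iota 0 4] in
  tabulate 14 14 (fun i j =>
    odd `|foldr (fun n s => (entry 0 (nth [::] p n) i j %/ n`!)%Z + s) 0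
            (iota 0 4)|).

Lemma root_tableE k :
  G2_x k (1 : 'F_2) = \matrix_(i, j) F2 (entry false (root_table k) i j).
Proof.
apply/matrixP=> i j; rewrite [RHS]mxE entry_tabulate // -F2_int.
rewrite -(big_ord_foldr _ _ _ (fun n => (entry 0 (nth [::] _ n) i j %/ n`!)%Z)).
rewrite rmorph_sum summxE; apply: eq_bigr => n _.
by rewrite (nth_map 0%N) ?size_iota ?nth_iota // expr1n scale1r !mxE ad_powE mxE.
Qed.

Definition root_tables : seq (seq bitseq) :=
  Eval vm_compute in [seq root_table k | k <- iota 0 12].

Lemma root_tablesE : root_tables = [seq root_table k | k <- iota 0 12].
Proof. by vm_compute. Qed.

Definition root_act (k : nat) (v : bitseq) : bitseq :=
  seq_row_mul 14 v (nth [::] root_tables k).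

Lemma big_F2 n (F : 'I_n -> bool) :
  F2 (\sum_(i < n) F i) = \sum_(i < n) F2 (F i).
Proof.
have F2D : {morph F2 : x y / x + y} by case=> [] []; apply: val_inj.
have F20 : F2 0 = 0 by apply: val_inj.
exact: (big_morph F2 F2D F20).
Qed.

Definition F2_row (v : bitseq) : 'rV['F_2]_14 := \row_j F2 (nth false v j).

Lemma F2_row_act k v : (k < 12)%N ->
  F2_row (root_act k v) = F2_row v *m G2_x k (1 : 'F_2).
Proof.
move=> ltk; apply/rowP=> j; rewrite root_tableE !mxE.
have size_table : size (nth [::] root_tables k) = 14.
  by rewrite root_tablesE (nth_map 0%N) ?size_iota // size_tabulate.
rewrite /root_act (nth_seq_row_mul _ _ _ (m := 14)) ?size_table // big_F2.
apply: eq_bigr => i _; rewrite !mxE root_tablesE.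
rewrite (nth_map 0%N) ?size_iota ?nth_iota //.
by case: (nth _ v _); case: (entry _ _ _ _); apply: val_inj.
Qed.

Definition root_elt (k : 'I_12) : {'GL_14['F_2]} :=
  FinRing.Unit (G2_x_unit 1 (ltn_ord k)).

(** The parameter of a root element over F_2 is 0 or 1, and it gives the
    identity when it is 0. *)
Lemma chevalley_G2_F2 : chevalley_G2 'F_2 = <<[set root_elt k | k : 'I_12]>>%g.
Proof.
apply/eqP; rewrite eqEsubset !gen_subG; apply/andP; split; apply/subsetP=> g.
  rewrite inE => /existsP[k /existsP[t /eqP g_xt]].
  have [t0|t1] : t = 0 \/ t = 1.
    by case: t {g_xt} => [[|[|//]] ltt]; [left|right]; apply: val_inj.
    suff -> : g = 1%g by exact: group1.
    by apply: val_inj; rewrite /= g_xt t0 G2_x0.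
  apply: mem_gen; apply/imsetP; exists k => //; apply: val_inj.
  by rewrite /= g_xt t1.
case/imsetP=> k _ ->; apply: mem_gen; rewrite inE.
by apply/existsP; exists k; apply/existsP; exists 1.
Qed.

(** * The 36 subalgebras of type A_2 spanned by long roots *)

Definition long_roots := [:: 1; 4; 5; 7; 10; 11]%N.

(** The six elements x_r(1), r a long root, generate the group SL_3(2) of the
    subsystem A_2; the orbit of a long root vector under it consists of the
    21 long root vectors of the subalgebra sl_3. Six rounds exhaust this
    orbit. *)
Definition A2_root_vectors : seq bitseq :=
  iter 6 (fun s =>
      undup (s ++ flatten [seq [seq root_act k v | v <- s] | k <- long_roots]))
    [:: [seq j == 1%N | j <- iota 0 14]].

(** The word number v, read from left to right in the root elements x_k(1),
    carries the standard subalgebra sl_3 to the one numbered v. The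
    numbering is chosen so that it agrees with the order of the unit vectors
    in [unit_triples]. *)
Definition A2_words : seq (seq nat) := [::
  [::]; [:: 0]; [:: 6]; [:: 0; 1; 9]; [:: 0; 3; 10]; [:: 0; 2; 9];
  [:: 0; 9; 2]; [:: 2; 3]; [:: 0; 2]; [:: 3; 6]; [:: 8]; [:: 0; 8]; [:: 6; 7];
  [:: 2; 11]; [:: 0; 1; 10]; [:: 2; 9]; [:: 0; 2; 10]; [:: 3; 11]; [:: 3; 8];
  [:: 3; 10; 7]; [:: 2]; [:: 0; 1]; [:: 2; 6]; [:: 8; 9]; [:: 0; 9];
  [:: 6; 8]; [:: 0; 8; 1]; [:: 9]; [:: 0; 10]; [:: 6; 9]; [:: 2; 3; 11];
  [:: 0; 2; 11]; [:: 2; 9; 0]; [:: 3]; [:: 0; 3]; [:: 3; 10]]%N.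

(** Each subalgebra is represented by its 21 long root vectors. *)
Definition A2_subalgebras : seq (seq bitseq) := Eval vm_compute in
  [seq [seq foldl (fun v k => root_act k v) e w | e <- A2_root_vectors]
     | w <- A2_words].

Definition common_sum_table : seq (seq bitseq) := Eval vm_compute in
  [seq [seq foldr (@seq_add bool) (nseq 14 false) [seq e <- s | e \in t]
          | t <- A2_subalgebras]
     | s <- A2_subalgebras].

(** The permutation of the 36 subalgebras induced by each root element. *)
Definition root_action : seq (seq nat) := Eval vm_compute in
  [seq [seq (let s' := [seq root_act k e | e <- s] in
             find (fun t => all (mem t) s') A2_subalgebras)
          | s <- A2_subalgebras]
     | k <- iota 0 12].

Definition A2_adjacency : seq bitseq := Eval vm_compute in
  [seq [seq has (nth false v) (iota 0 14) | v <- s] | s <- common_sum_table].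

Lemma root_action_perm :
  all (fun p => [&& size p == 36, all (fun i => i < 36)%N p & uniq p])
    root_action.
Proof. by vm_compute. Qed.

Lemma common_sum_table_act :
  all (fun k => let p := nth [::] root_action k in
    all (fun u => let r := nth [::] common_sum_table (nth 0%N p u) in
                  let s := nth [::] common_sum_table u in
      all (fun v => nth [::] r (nth 0%N p v) == root_act k (nth [::] s v))
    (iota 0 36)) (iota 0 36)) (iota 0 12).
Proof. by vm_compute. Qed.

Lemma A2_adjacencyP :
  all (fun u => all (fun v => entry false A2_adjacency u v ==
      has (nth false (entry [::] common_sum_table u v)) (iota 0 14))
    (iota 0 36)) (iota 0 36).
Proof. by vm_compute. Qed.

Lemma size_common_sum_table :
  all (fun s => (size s == 36) && all (fun v => size v == 14) s)
    common_sum_table.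
Proof. by vm_compute. Qed.

Lemma common_sum_row_neq :
  all (fun u => all (fun u' => (u != u') ==>
    let s := nth [::] common_sum_table u in
    let s' := nth [::] common_sum_table u' in
    has (fun v => nth [::] s v \notin s') (iota 0 36)) (iota 0 36)) (iota 0 36).
Proof. by vm_compute. Qed.

(** For each vector of the standard basis of F_2^14, pairs of subalgebras such
    that the values of [common_sum] at these pairs have that vector as sum. *)
Definition common_sum_basis : seq (seq (nat * nat)) := [::
  [:: (0, 22); (1, 9); (0, 26); (1, 5)]; [:: (0, 22)];
  [:: (0, 11); (6, 25); (0, 26); (1, 26)];
  [:: (0, 29); (3, 24); (0, 4); (2, 4)]; [:: (0, 34)]; [:: (0, 7)];
  [:: (0, 34); (1, 9); (0, 4); (2, 16)]; [:: (0, 11)];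
  [:: (0, 22); (6, 18); (0, 26); (2, 26)];
  [:: (0, 34); (3, 15); (0, 4); (1, 4)]; [:: (0, 29)]; [:: (0, 23)];
  [:: (0, 7); (0, 23); (0, 30)]; [:: (0, 22); (0, 11); (0, 26)]]%N.

Lemma common_sum_basisE :
  [seq foldr (fun x => seq_add (entry [::] common_sum_table x.1 x.2))
         (nseq 14 false) s
     | s <- common_sum_basis]
    = tabulate 14 14 (fun i j => i == j).
Proof. by vm_compute. Qed.

Lemma F2_row_add v w : F2_row (seq_add v w) = F2_row v + F2_row w.
Proof.
apply/rowP=> j; rewrite !mxE (nth_seq_add v w).
by case: (nth _ v _); case: (nth _ w _); apply: val_inj.
Qed.

Lemma F2_row_neq0 v : (F2_row v != 0) = has (nth false v) (iota 0 14).
Proof.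
apply/rV0Pn/hasP => [[j]|[j]].
  rewrite mxE => vj; exists (val j); first by rewrite mem_iota ltn_ord.
  by move: vj; case: (nth _ v _).
rewrite mem_iota => ltj vj; exists (Ordinal ltj).
by rewrite mxE /= vj.
Qed.

Lemma F2_row_inj v w :
  size v = 14 -> size w = 14 -> F2_row v = F2_row w -> v = w.
Proof.
move=> sv sw /rowP eq_vw.
apply: (eq_from_nth (x0 := false)); rewrite ?sw // sv => j ltj.
have := eq_vw (Ordinal ltj); rewrite !mxE /=.
by case: (nth _ v j); case: (nth _ w j).
Qed.

Definition common_sum (u v : 'I_36) : 'rV['F_2]_14 :=
  F2_row (entry [::] common_sum_table u v).

Definition A2_graph : rel 'I_36 := fun u v => entry false A2_adjacency u v.

Lemma A2_graphE u v : A2_graph u v = (common_sum u v != 0).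
Proof.
rewrite F2_row_neq0; apply/eqP.
have /all_iotaP/(_ u (ltn_ord u))/all_iotaP := A2_adjacencyP.
by move=> /(_ v (ltn_ord v)).
Qed.

(** * Automorphisms of the graph of subalgebras *)

Lemma root_permP k : (k < 12)%N ->
  injective (fun i : 'I_36 => inord (entry 0%N root_action k i) : 'I_36).
Proof.
move=> ltk i j /(congr1 val)/=.
have /(all_nthP [::])/(_ k ltk)/and3P[/eqP sz /(all_nthP 0%N) lt36 uniq_p] :=
  root_action_perm.
rewrite !inordK ?lt36 ?sz // => /eqP.
by rewrite nth_uniq ?sz // => /eqP/val_inj.
Qed.

Definition root_perm (k : 'I_12) : 'S_36 := perm (root_permP (ltn_ord k)).

Lemma root_permE k i : root_perm k i = entry 0%N root_action k i :> nat.
Proof.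
have /(all_nthP [::])/(_ k (ltn_ord k)) := root_action_perm.
case/and3P=> /eqP sz /(all_nthP 0%N) lt36 _.
by rewrite permE inordK ?lt36 ?sz.
Qed.

Definition equivariant : {set 'S_36 * {'GL_14['F_2]}} :=
  [set x : 'S_36 * {'GL_14['F_2]} |
    [forall u, forall v,
       common_sum (x.1 u) (x.1 v) == common_sum u v *m GLval x.2]].

Lemma equivariantP (p : 'S_36) (g : {'GL_14['F_2]}) :
  reflect (forall u v, common_sum (p u) (p v) = common_sum u v *m GLval g)
          ((p, g) \in equivariant).
Proof.
rewrite inE; apply: (iffP forallP) => [h u v | h u].
  by have /forallP/(_ v)/eqP := h u.
by apply/forallP=> v; rewrite h.
Qed.

Lemma equivariant_group_set : group_set equivariant.
Proof.
apply/group_setP; split=> [|[p g] [q g'] /equivariantP pg /equivariantP qg].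
  by apply/equivariantP=> u v; rewrite !perm1 mulmx1.
by apply/equivariantP=> u v; rewrite !permM qg pg -mulmxA.
Qed.

Canonical equivariant_group := Group equivariant_group_set.

Lemma root_equivariant k : (root_perm k, root_elt k) \in equivariant.
Proof.
apply/equivariantP=> u v; rewrite /common_sum /= -F2_row_act //; congr F2_row.
have /all_iotaP/(_ k (ltn_ord k))/all_iotaP/(_ u (ltn_ord u)) := common_sum_table_act.
by move=> /all_iotaP/(_ v (ltn_ord v))/eqP <-; rewrite /entry !root_permE.
Qed.

(** The values of [common_sum] span the module, and g fixes each of them. *)
Lemma equivariant_1g (g : {'GL_14['F_2]}) : (1%g, g) \in equivariant -> g = 1%g.
Proof.
move=> /equivariantP pair_g; apply: val_inj; apply/row_matrixP=> i.
pose lt36 (x : nat * nat) := ((x.1 < 36) && (x.2 < 36))%N.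
pose add_at (x : nat * nat) := seq_add (entry [::] common_sum_table x.1 x.2).
have fix_g s : all lt36 s ->
    F2_row (foldr add_at (nseq 14 false) s) *m GLval g
      = F2_row (foldr add_at (nseq 14 false) s).
  elim: s => [_|[u v] s IHs /= /andP[/andP[ltu ltv] lt_s]].
    suff -> : F2_row (nseq 14 false) = 0 by rewrite mul0mx.
    by apply/rowP=> j; rewrite !mxE nth_nseq if_same.
  rewrite F2_row_add mulmxDl IHs //; congr (_ + _).
  by have := pair_g (Ordinal ltu) (Ordinal ltv); rewrite !perm1.
have row1 : F2_row (nth [::] (tabulate 14 14 (fun i j => i == j)) i) = row i 1%:M.
  by apply/rowP=> j; rewrite !mxE -/(entry _ _ _ _) entry_tabulate.
rewrite -[LHS]/(row i (GLval g)) -[RHS]/(row i 1%:M).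
rewrite -row1 -[GLval g]mul1mx row_mul -row1 -common_sum_basisE.
rewrite (nth_map [::]) //; apply: fix_g.
have /(all_nthP [::]) lt_basis : all (all lt36) common_sum_basis by [].
exact: lt_basis.
Qed.

(** A subalgebra is determined by the set of values of [common_sum] in its row,
    which p preserves. *)
Lemma equivariant_g1 (p : 'S_36) : (p, 1%g) \in equivariant -> p = 1%g.
Proof.
move=> /equivariantP pair_p; apply/permP=> u; rewrite perm1.
apply/eqP/contraT=> neq_pu.
have size_row (v : 'I_36) : size (nth [::] common_sum_table v) = 36 /\
    forall w : 'I_36, size (entry [::] common_sum_table v w) = 14.
  have /(all_nthP [::])/(_ v (ltn_ord v)) := size_common_sum_table.
  case/andP=> /eqP sz /(all_nthP [::]) szw.
  by split=> // w; apply/eqP/szw; rewrite sz.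
have /all_iotaP/(_ u (ltn_ord u))/all_iotaP := common_sum_row_neq.
move=> /(_ (p u) (ltn_ord _))/implyP; rewrite eq_sym => /(_ neq_pu)/hasP[w].
rewrite mem_iota => ltw /negP[].
have [[szu szuw] [szp szpw]] := (size_row u, size_row (p u)).
have <- : entry [::] common_sum_table (p u) (p (Ordinal ltw))
    = nth [::] (nth [::] common_sum_table u) w.
  apply: F2_row_inj; [exact: szpw | exact: (szuw (Ordinal ltw)) |].
  by have := pair_p u (Ordinal ltw); rewrite mulmx1.
by rewrite mem_nth ?szp.
Qed.

(** Adjacency means that [common_sum] is not 0, and g is injective. *)
Lemma equivariant_aut x : x \in equivariant -> x.1 \in graph_aut A2_graph.
Proof.
case: x => p g /equivariantP pg; apply/graph_autP=> u v.
rewrite !A2_graphE pg; congr (~~ _).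
by rewrite -{1}[0](mul0mx _ (GLval g)) (inj_eq (can_inj (mulmxK (GL_unit g)))).
Qed.

Definition word_perm (w : seq nat) : 'S_36 :=
  (\prod_(k <- w) root_perm (inord k))%g.

Definition word_image (w : seq nat) v :=
  foldl (fun v k => entry 0%N root_action k v) v w.

Lemma word_permE w (v : 'I_36) : all (fun k => k < 12)%N w ->
  word_perm w v = word_image w v :> nat.
Proof.
rewrite /word_perm; elim: w v => [|k w IHw] v; first by rewrite big_nil perm1.
by case/andP=> ltk ltw; rewrite big_cons permM IHw //= root_permE inordK.
Qed.

(** What an automorphism that fixes the vertices bs and maps b to v has to
    respect. *)
Definition same_adjacencies bs b v :=
  all (fun c => (entry false A2_adjacency v c == entry false A2_adjacency b c)
                && ((v == c) == (b == c))) bs.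

(** The pointwise stabilizer of bs in the group generated by the root elements
    is described by a chain of base points b. At each step, any vertex v
    that an automorphism fixing bs could be the image of b must be brought
    back to b by one of the words ws, and this word must fix bs. At the end
    the base points must separate all vertices. *)
Fixpoint sifts (bs : seq nat) (chain : seq (nat * seq (seq nat))) : bool :=
  if chain is (b, ws) :: chain' then
    [&& (b < 36)%N,
        all (fun v => same_adjacencies bs b v ==>
          has (fun w => [&& all (fun k => k < 12)%N w, word_image w v == b &
                            all (fun c => word_image w c == c) bs]) ws)
          (iota 0 36)
      & sifts (b :: bs) chain']
  else all (fun u => all (fun v => same_adjacencies bs u v ==> (u == v))
                       (iota 0 36)) (iota 0 36).

(** If p maps b to v, composing p with the word that brings v back to b gives an
    automorphism that also fixes b; at the end of the chain nothing but the
    identity is left. *)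
Lemma sifts_aut chain bs (p : 'S_36) :
    sifts bs chain -> p \in graph_aut A2_graph ->
    {in bs, forall b, exists2 u : 'I_36, val u = b & p u = u} ->
  p \in <<[set root_perm k | k : 'I_12]>>%g.
Proof.
have looks (s : seq nat) (q : 'S_36) (u : 'I_36) : q \in graph_aut A2_graph ->
    {in s, forall b, exists2 u : 'I_36, val u = b & q u = u} ->
  same_adjacencies s u (q u).
  move=> /graph_autP aut_q fix_q; apply/allP=> _ /fix_q[c <- qc].
  rewrite -[entry _ _ _ _]/(A2_graph (q u) c) -{1}qc aut_q eqxx /=.
  by rewrite -{1}qc !(inj_eq val_inj) (inj_eq perm_inj).
elim: chain bs p => [|[b ws] chain IH] bs p.
  move=> /all_iotaP sep aut_p fix_p; suff -> : p = 1%g by exact: group1.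
  apply/permP=> u; rewrite perm1; apply/esym/eqP.
  have /all_iotaP/(_ (p u) (ltn_ord _))/implyP := sep u (ltn_ord u).
  by apply; exact: looks.
case/and3P=> ltb /all_iotaP ex_w sift aut_p fix_p; pose u := Ordinal ltb.
have /implyP/(_ (looks bs p u aut_p fix_p))/hasP[w _] := ex_w (p u) (ltn_ord _).
case/and3P=> ltw /eqP wpu /allP w_bs.
have w_gen : word_perm w \in <<[set root_perm k | k : 'I_12]>>%g.
  by apply: group_prod => k _; apply: mem_gen; apply: imset_f.
have w_aut : word_perm w \in graph_aut A2_graph.
  apply: group_prod => k _.
  exact: (equivariant_aut (root_equivariant (inord k))).
rewrite -(groupMr _ w_gen); apply: (IH (b :: bs)) => //; first exact: groupM.
move=> c; rewrite inE => /orP[/eqP->|c_bs].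
  by exists u => //; apply: ord_inj; rewrite permM word_permE.
have [v vc pv] := fix_p c c_bs; exists v => //.
apply: ord_inj; rewrite permM pv word_permE //.
by rewrite [nat_of_ord v]vc (eqP (w_bs c c_bs)).
Qed.

(** The orbits have lengths 36, 14, 4 and 6, whose product is 12096, the order
    of G_2(2). The pointwise stabilizer of the vertices 0, 1, 2 and 3 is
    trivial, but adjacency to these four does not separate the other
    vertices, and this is what the last three base points are for. As root
    elements over F_2 are involutions, reversing a word inverts it. *)
Definition stabilizer_chain : seq (nat * seq (seq nat)) := [::
  (0, map rev A2_words);
  (1, [:: [::]; [:: 0; 6; 0]; [:: 3; 9; 3]; [:: 0; 6; 0; 10]; [:: 4; 1; 10];
  [:: 1; 10]; [:: 2; 8; 1; 2]; [:: 0; 4; 6; 0; 10]; [:: 7; 1]; [:: 1];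
  [:: 4; 10]; [:: 10]; [:: 2; 8; 2]; [:: 0; 4; 6; 0]]);
  (2, [:: [::]; [:: 7]; [:: 4; 7]; [:: 4]]);
  (3, [:: [::]; [:: 11; 5]; [:: 5; 11]; [:: 5]; [:: 5; 11; 5]; [:: 11]]);
  (7, [:: [::]]);
  (11, [:: [::]]);
  (18, [:: [::]])]%N.

Lemma stabilizer_chain_sifts : sifts [::] stabilizer_chain.
Proof. by vm_compute. Qed.

Lemma graph_aut_A2 : graph_aut A2_graph = <<[set root_perm k | k : 'I_12]>>%g.
Proof.
apply/eqP; rewrite eqEsubset gen_subG; apply/andP; split; apply/subsetP=> p.
  by move=> aut_p; apply: (sifts_aut stabilizer_chain_sifts).
by case/imsetP=> k _ ->; apply: (equivariant_aut (root_equivariant k)).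
Qed.

Theorem graph_aut_A2_isog : graph_aut A2_graph \isog chevalley_G2 'F_2.
Proof.
rewrite graph_aut_A2 chevalley_G2_F2.
exact: (isog_gen_of_pairs root_equivariant equivariant_1g equivariant_g1).
Qed.

(** * Coordinates for a field of order 4 *)

(** The pair (a, b) stands for a + b w, where w^2 = w + 1, so that addition is
    the componentwise one. *)
Definition gf4 := (bool * bool)%type.

Definition gf4_mul (a b : gf4) : gf4 :=
  ((a.1 && b.1) (+) (a.2 && b.2),
   (a.1 && b.2) (+) (a.2 && b.1) (+) (a.2 && b.2)).

Definition gf4_conj (a : gf4) : gf4 := (a.1 (+) a.2, a.2).
Definition gf4_1 : gf4 := (true, false).
Definition gf4_units : seq gf4 := [:: gf4_1; (false, true); (true, true)].
Definition gf4_enum : seq gf4 := 0 :: gf4_units.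

Section FieldOfOrder4.
Variable F : finFieldType.
Hypothesis cardF : #|F| = 4%N.

(** As x^4 = x for all x, the element -1 = (-1)^4 is 1. *)
Lemma addrr_card4 (a : F) : a + a = 0.
Proof.
have m1 : (-1 : F) = 1 by rewrite -[LHS]expf_card cardF -signr_odd expr0.
by rewrite -{2}[a]mul1r -m1 mulN1r subrr.
Qed.

(** Any w other than 0 and 1 is a root of X^4 - X = X (X - 1) (X^2 + X + 1). *)
Lemma exists_primitive_card4 : exists w : F, w * w = w + 1.
Proof.
have /card_gt0P[w] : (0 < #|predC (pred2 (0%R : F) 1%R)|)%N.
  rewrite -(ltn_add2l #|pred2 (0%R : F) 1%R|) cardC cardF card2 addn0.
  by case: eqP.
rewrite !inE negb_or => /andP[w0 w1]; exists w; apply/eqP.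
have w4 : w ^+ 4 = w by rewrite -cardF expf_card.
have : w * (w - 1) * (w * w + w + 1) = 0.
  by rewrite (_ : _ * _ = w ^+ 4 - w); [rewrite w4 subrr | ring].
move/eqP; rewrite !mulf_eq0 (negPf w0) subr_eq0 (negPf w1) /= -addrA addr_eq0.
move=> /eqP ->; apply/eqP/esym; apply: (addrI (w + 1)).
by rewrite addrr_card4 subrr.
Qed.

Variable w : F.
Hypothesis w2 : w * w = w + 1.

Definition gf4_val (a : gf4) : F := (a.1 : nat)%:R + (a.2 : nat)%:R * w.

Let F_add (a b : bool) :
  ((a (+) b : bool) : nat)%:R = (a : nat)%:R + (b : nat)%:R :> F.
Proof. by case: a; case: b; rewrite /= ?addr0 ?add0r ?addrr_card4. Qed.

Let F_mul (a b : bool) :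
  ((a && b : bool) : nat)%:R = (a : nat)%:R * (b : nat)%:R :> F.
Proof. by case: a; rewrite /= ?mul1r ?mul0r. Qed.

Lemma gf4_valD a b : gf4_val (a + b) = gf4_val a + gf4_val b.
Proof. by rewrite /gf4_val !F_add; ring. Qed.

Lemma gf4_valM a b : gf4_val (gf4_mul a b) = gf4_val a * gf4_val b.
Proof. by rewrite /gf4_val !(F_add, F_mul); ring: w2. Qed.

Lemma gf4_val_sqr a : gf4_val a ^+ 2 = gf4_val (gf4_conj a).
Proof. by rewrite expr2 -gf4_valM; case: a => [[] []]. Qed.

Lemma gf4_val0 : gf4_val 0 = 0.
Proof. by rewrite /gf4_val mul0r addr0. Qed.

Lemma gf4_val1 : gf4_val gf4_1 = 1.
Proof. by rewrite /gf4_val mul0r addr0. Qed.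

Lemma gf4_val_inj : injective gf4_val.
Proof.
have val_eq0 a : gf4_val a = 0 -> a = 0.
  move=> a0; apply/eqP/contraT => nz_a.
  have [b ab] : exists b, gf4_mul a b = gf4_1.
    case: a nz_a {a0} => [[] []] //= _;
      by [exists (false, true) | exists gf4_1 | exists (true, true)].
  have /eqP := gf4_val1.
  by rewrite -ab gf4_valM a0 mul0r eq_sym oner_eq0.
move=> a b eq_ab; have ab0 : a + b = 0.
  by apply: val_eq0; rewrite gf4_valD eq_ab addrr_card4.
by case: a b ab0 {eq_ab} => [[] []] [[] []].
Qed.

Lemma gf4_val_surj (x : F) : exists a, gf4_val a = x.
Proof.
have [g _ gK] : bijective gf4_val.
  by apply: inj_card_bij gf4_val_inj _; rewrite card_prod card_bool cardF.
by exists (g x).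
Qed.

End FieldOfOrder4.

(** * Orthonormal frames of a hermitian space *)

Section HermitianSpace.
Variables (F : finFieldType) (theta : {rmorphism F -> F}) (V : vectType F).
Variable h : {hermitian V for false & theta}.
Hypotheses (cardF : #|F| = 4%N) (thetaE : forall a : F, theta a = a ^+ 2).

Lemma herm_conj x y : h x y = theta (h y x).
Proof. by rewrite hermC expr0 mul1r. Qed.

Lemma herm_norm1 x : h x x != 0 -> h x x = 1.
Proof.
by move=> nz; apply: (mulfI nz); rewrite mulr1 -expr2 -thetaE -herm_conj.
Qed.

(** By polarization h x y + h y x = 0 on U. Replacing x by w x, where w is not
    fixed by conjugation, gives a second relation, and the two together
    force h x y = 0. *)
Lemma totally_isotropic (U : {vspace V}) :
  {in U, forall x, h x x = 0} -> {in U &, forall x y, h x y = 0}.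
Proof.
move=> iso x y Ux Uy; have [w w2] := exists_primitive_card4 cardF.
have polar a b : a \in U -> b \in U -> h a b + h b a = 0.
  move=> Ua Ub; have := iso _ (rpredD Ua Ub).
  by rewrite linearDl !linearDr /= !iso // add0r addr0.
have Uwx : w *: x \in U by exact: rpredZ.
(* w h x y + w^2 h y x = 0, where w^2 = w + 1 and h x y = - h y x. *)
have := polar _ _ Uwx Uy; rewrite linearZl_LR linearZr_LR /= thetaE expr2 w2.
have := polar _ _ Ux Uy => /eqP; rewrite addr_eq0 => /eqP xy.
rewrite xy mulrN mulrDl mul1r addrA addNr add0r => yx.
by rewrite yx oppr0.
Qed.

Hypothesis h_nondeg : nondegenerate h.

(** If the orthogonal space of W contained no unit vector, the form would vanish
    on it; as V = W + W^perp, that space would lie in the radical, so W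
    would be all of V. *)
Lemma exists_unit_orthov (W : {vspace V}) :
    (forall x, exists2 p, p \in W & x - p \in orthov h W) ->
    (\dim W < \dim {:V})%N ->
  exists2 e, e \in orthov h W & h e e = 1.
Proof.
move=> projW lt_dim.
have [/existsP[e /andP[We /herm_norm1]]|/existsPn iso] :=
    boolP [exists e : finvect_type V, (e \in orthov h W) && (h e e != 0)].
  by exists e.
have {}iso : {in orthov h W &, forall x y, h x y = 0}.
  by apply: totally_isotropic => x Wx; have := iso x; rewrite Wx negbK => /eqP.
have W0 x : x \in orthov h W -> x = 0.
  move=> Wx; apply/eqP; rewrite -memv0 -(eqP h_nondeg); apply/mem_orthovP=> y _.
  have [p Wp Wyp] := projW y.
  have xp0 : h x p = 0 by move/mem_orthovP: Wx; apply.
  by rewrite -[y](subrK p) linearDr /= iso // add0r.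
suff : (fullv <= W)%VS by move/dimvS; rewrite leqNgt lt_dim.
apply/subvP=> x _; have [p Wp /W0/eqP] := projW x.
by rewrite subr_eq0 => /eqP ->.
Qed.

Lemma exists_orthonormal_frame e1 : h e1 e1 = 1 -> \dim {:V} = 3%N ->
  exists e2 e3, orthonormal h [:: e1; e2; e3].
Proof.
move=> n1 dimV.
have sym0 x y : h x y = 0 -> h y x = 0.
  by move=> xy0; rewrite herm_conj xy0 rmorph0.
have [e2 /[!mem_orthov1] /eqP h21 n2] :
    exists2 e2, e2 \in orthov h <[e1]> & h e2 e2 = 1.
  apply: exists_unit_orthov => [x|]; last by rewrite dimV dim_vline; case: eqP.
  exists (h x e1 *: e1); first by rewrite memvZ ?memv_line.
  by rewrite mem_orthov1 linearBl linearZl_LR /= n1 mulr1 subrr.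
have h12 := sym0 _ _ h21.
have [e3 W3 n3] :
    exists2 e3, e3 \in orthov h (<[e1]> + <[e2]>) & h e3 e3 = 1.
  apply: exists_unit_orthov => [x|]; last first.
    rewrite dimV (leq_ltn_trans (dimv_add_leqif _ _)) // !dim_vline.
    by case: eqP; case: eqP.
  exists (h x e1 *: e1 + h x e2 *: e2).
    by rewrite memv_add ?memvZ ?memv_line.
  rewrite memvE orthovD -!memvE !mem_orthov1.
  rewrite !linearBl !linearDl !linearZl_LR /= n1 n2 h12 h21.
  by rewrite !mulr1 !mulr0 addr0 add0r !subrr eqxx.
move: W3; rewrite memvE orthovD -!memvE !mem_orthov1 => /andP[/eqP h31 /eqP h32].
exists e2, e3; rewrite /orthonormal /ortho_rec /= n1 n2 n3 h12.
by rewrite (sym0 _ _ h31) (sym0 _ _ h32) !eqxx.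
Qed.

End HermitianSpace.

Definition triple := (gf4 * gf4 * gf4)%type.

Definition triple_scale (a : gf4) (x : triple) : triple :=
  (gf4_mul a x.1.1, gf4_mul a x.1.2, gf4_mul a x.2).

Definition triple_herm (x y : triple) : gf4 :=
  gf4_mul x.1.1 (gf4_conj y.1.1) + gf4_mul x.1.2 (gf4_conj y.1.2)
    + gf4_mul x.2 (gf4_conj y.2).

Definition triples : seq triple :=
  [seq (x, c) | x <- [seq (a, b) | a <- gf4_enum, b <- gf4_enum],
                c <- gf4_enum].

Definition unit_triples : seq triple :=
  Eval vm_compute in [seq x <- triples | triple_herm x x == gf4_1].

Lemma card_finvect (F : finFieldType) (V : vectType F) :
  #|finvect_type V| = (#|F| ^ \dim {:V})%N.
Proof.
rewrite -(@card_vspacef F (finvect_type V) (Vector.class (finvect_type V))).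
by rewrite card_vspace.
Qed.

Section Frame.
Variables (F : finFieldType) (theta : {rmorphism F -> F}) (V : vectType F).
Variable h : {hermitian V for false & theta}.
Hypotheses (cardF : #|F| = 4%N) (thetaE : forall a : F, theta a = a ^+ 2).
Variables (w : F) (w2 : w * w = w + 1).

Local Notation val4 := (gf4_val w).

Definition frame_vector (e1 e2 e3 : V) (x : triple) : V :=
  val4 x.1.1 *: e1 + val4 x.1.2 *: e2 + val4 x.2 *: e3.

Lemma frame_vectorD e1 e2 e3 x y :
  frame_vector e1 e2 e3 (x + y)
    = frame_vector e1 e2 e3 x + frame_vector e1 e2 e3 y.
Proof.
rewrite /frame_vector !(gf4_valD cardF) !scalerDl.
by rewrite [RHS]addrACA [X in X + _ = _]addrACA.
Qed.

Lemma frame_vectorZ e1 e2 e3 a x :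
  frame_vector e1 e2 e3 (triple_scale a x) = val4 a *: frame_vector e1 e2 e3 x.
Proof. by rewrite /frame_vector !(gf4_valM cardF w2) !scalerDr !scalerA. Qed.

Variables e1 e2 e3 : V.
Hypothesis frame : orthonormal h [:: e1; e2; e3].
Local Notation vec := (frame_vector e1 e2 e3).

Lemma frame_vector_herm x y : h (vec x) (vec y) = val4 (triple_herm x y).
Proof.
case/andP: frame => /and4P[/eqP n1 /eqP n2 /eqP n3 _].
rewrite /ortho_rec /= !andbT => /andP[/andP[/eqP h12 /eqP h13] /eqP h23].
have sym0 a b : h a b = 0 -> h b a = 0.
  by move=> ab0; rewrite (herm_conj h) ab0 rmorph0.
rewrite /frame_vector !linearDl !linearDr !linearZl_LR !linearZr_LR /=.
rewrite n1 n2 n3 h12 h13 h23.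
rewrite (sym0 _ _ h12) (sym0 _ _ h13) (sym0 _ _ h23) !thetaE.
rewrite !(gf4_val_sqr cardF w2) !(mulr0, mulr1, addr0, add0r).
by rewrite !(gf4_valD cardF, gf4_valM cardF w2).
Qed.

Lemma frame_vector_inj : injective vec.
Proof.
move=> x y eq_xy; have coord a : triple_herm x a = triple_herm y a.
  by apply: (gf4_val_inj cardF w2); rewrite -!frame_vector_herm eq_xy.
have projE z : [/\ triple_herm z (gf4_1, 0, 0) = z.1.1,
    triple_herm z (0, gf4_1, 0) = z.1.2 & triple_herm z (0, 0, gf4_1) = z.2].
  by case: z => [[[[] []] [[] []]] [[] []]].
have [x1 x2 x3] := projE x; have [y1 y2 y3] := projE y.
rewrite !coord in x1 x2 x3.
case: x y x1 x2 x3 y1 y2 y3 {eq_xy coord} => [[? ?] ?] [[? ?] ?] /=.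
by move=> <- <- <- -> -> ->.
Qed.

Lemma frame_vector_surj : \dim {:V} = 3%N -> forall v, exists x, vec x = v.
Proof.
move=> dimV v; have [g _ gK] : bijective (vec : triple -> finvect_type V).
  apply: (@inj_card_bij triple (finvect_type V) vec frame_vector_inj).
  by rewrite !card_prod card_bool card_finvect cardF dimV.
by exists (g v).
Qed.

End Frame.

(** * Hyperovals of non-isotropic points *)

(** The points of two orthonormal frames: the three coordinate points, and the
    points of non-zero product of coordinates equal to k. The latter
    condition does not depend on the scaling, since a^3 = 1 for a non-zero
    in F_4. For k a unit, the three points (x, y, z) with xyz = k are
    pairwise orthogonal. *)
Definition two_frames (k : gf4) (x : triple) : bool :=
  (count (pred1 0) [:: x.1.1; x.1.2; x.2] == 2)
  || (gf4_mul (gf4_mul x.1.1 x.1.2) x.2 == k).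

(** Representatives of the 12 non-isotropic points, normalized so that the first
    non-zero coordinate is 1. *)
Definition points : seq triple := Eval vm_compute in
  [seq x <- unit_triples |
     ohead [seq a <- [:: x.1.1; x.1.2; x.2] | a != 0] == Some gf4_1].

Definition point i : triple := nth 0 points i.

Definition collinear_triples : seq (nat * nat * nat) := Eval vm_compute in
  [seq t <- [seq (t, k) | t <- [seq (i, j) | i <- iota 0 12, j <- iota 0 12],
                          k <- iota 0 12] |
    [&& (t.1.1 < t.1.2)%N, (t.1.2 < t.2)%N & has (fun a => has (fun b =>
      point t.2 == triple_scale a (point t.1.1) + triple_scale b (point t.1.2))
     gf4_enum) gf4_enum]].

(** A set of non-isotropic points is given by its list of memberships, in the
    order of [points]. *)
Definition no_three_collinear (m : bitseq) : bool :=
  all (fun t => ~~ [&& nth false m t.1.1, nth false m t.1.2 & nth false m t.2])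
    collinear_triples.

(** Six non-isotropic points including P = (1, 0, 0), no three collinear: each
    of the five lines through P contains just one other of these points. For
    the two lines joining P to the other coordinate points there is only one
    candidate, so all three coordinate points occur. Lines through each of
    them contain at most one of the other three points, so the ratios of any
    two coordinates of these three points are distinct, which forces the
    product of their coordinates to be constant. *)
Lemma six_arcs : all_masks 12 (fun m =>
  [&& nth false m (index (gf4_1, 0, 0) points), (6 <= count id m)%N
    & no_three_collinear m]
   ==> has (fun k => m == map (two_frames k) points) gf4_units).
Proof. by vm_compute. Qed.

Lemma mem_unit_triples x : (x \in unit_triples) = (triple_herm x x == gf4_1).
Proof. by case: x => [[[[] []] [[] []]] [[] []]]. Qed.

Lemma unit_triples_points : all (fun x => has (fun p => has (fun a =>
    (x == triple_scale a p) &&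
    all (fun k => two_frames k x == two_frames k p) gf4_units)
  gf4_units) points) unit_triples.
Proof. by vm_compute. Qed.

Lemma points_not_proportional : all (fun i => all (fun j => all (fun a =>
    (i != j) ==> (triple_scale a (point i) != point j))
  gf4_enum) (iota 0 12)) (iota 0 12).
Proof. by vm_compute. Qed.

Lemma collinear_triplesP : all (fun t =>
  [&& (t.1.1 < t.1.2 < t.2)%N, (t.2 < 12)%N & has (fun a => has (fun b =>
      point t.2 == triple_scale a (point t.1.1) + triple_scale b (point t.1.2))
     gf4_enum) gf4_enum]) collinear_triples.
Proof. by vm_compute. Qed.

(** Multiplying the third vector of the frame by k keeps it a unit vector and
    turns the condition xyz = k into xyz = 1. *)
Lemma two_frames_rescale : all (fun k =>
  (gf4_mul k (gf4_conj k) == gf4_1) && all (fun x =>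
  let y := (x.1, gf4_mul x.2 k) in
  (y \in unit_triples) && (two_frames k y == two_frames gf4_1 x))
  unit_triples) gf4_units.
Proof. by vm_compute. Qed.

Lemma mem_gf4_enum a : a \in gf4_enum.
Proof. by case: a => [[] []]. Qed.

Lemma vline_scale (K : fieldType) (V : vectType K) (a : K) (v : V) :
  a != 0 -> <[a *: v]>%VS = <[v]>%VS.
Proof.
move=> nz_a; apply/eqP; rewrite eqEsubv -!memvE memvZ ?memv_line //=.
by apply/vlineP; exists a^-1; rewrite scalerA mulVf ?scale1r.
Qed.

Lemma dim1_vline (K : fieldType) (V : vectType K) (P : {vspace V}) :
  \dim P = 1%N -> exists2 x, x != 0 & P = <[x]>%VS.
Proof.
move=> dimP; have nz : vpick P != 0 by rewrite vpick0 -dimv_eq0 dimP.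
exists (vpick P) => //; apply/esym/eqP.
by rewrite eqEdim -memvE memv_pick dim_vline nz dimP.
Qed.

Section Hyperoval.
Variables (F : finFieldType) (theta : {rmorphism F -> F}) (V : vectType F).
Variable h : {hermitian V for false & theta}.
Variable H0 : {fset {vspace V}}.
Hypotheses (cardF : #|F| = 4%N) (thetaE : forall a : F, theta a = a ^+ 2).
Hypotheses (dimV : \dim {:V} = 3%N) (H0_hyperoval : hyperoval H0).
Hypothesis H0_nonisotropic :
  forall x : V, x != 0 -> <[x]>%VS \in H0 -> h x x != 0.

Lemma hyperoval_unit P : P \in H0 -> exists2 x, h x x = 1 & P = <[x]>%VS.
Proof.
case: H0_hyperoval => _ dim1 _ HP; have [x nzx Px] := dim1_vline (dim1 _ HP).
exists x => //; apply: (herm_norm1 thetaE).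
by apply: H0_nonisotropic; rewrite // -Px.
Qed.

Section InFrame.
Variables (w : F) (w2 : w * w = w + 1) (e1 e2 e3 : V).
Hypothesis frame : orthonormal h [:: e1; e2; e3].
Local Notation vec := (frame_vector w e1 e2 e3).
Local Notation line x := <[vec x]>%VS.

Lemma line_scale a x : a \in gf4_units -> line (triple_scale a x) = line x.
Proof.
move=> unit_a; rewrite (frame_vectorZ cardF w2) vline_scale //.
rewrite -(gf4_val0 w) (inj_eq (gf4_val_inj cardF w2)).
by apply: contraTneq unit_a => ->.
Qed.

Lemma unit_line v : h v v = 1 -> exists2 x, x \in unit_triples & vec x = v.
Proof.
have [x <-] := frame_vector_surj cardF thetaE w2 frame dimV v.
rewrite (frame_vector_herm cardF thetaE w2 frame) -(gf4_val1 w).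
move=> /(gf4_val_inj cardF w2) x1.
by exists x; rewrite // mem_unit_triples x1.
Qed.

Lemma point_lineP x : x \in unit_triples ->
  exists2 p, p \in points &
    line x = line p /\
    {in gf4_units, forall k, two_frames k x = two_frames k p}.
Proof.
move=> unit_x; have /allP/(_ x unit_x) := unit_triples_points.
case/hasP=> p point_p /hasP[a unit_a] /andP[] /eqP eq_x /allP same; exists p => //; split.
  by rewrite eq_x line_scale.
by move=> k /same/eqP.
Qed.

Lemma point_line_inj i j : (i < 12)%N -> (j < 12)%N ->
  line (point i) = line (point j) -> i = j.
Proof.
move=> lti ltj eq_ij; apply/eqP/contraT => neq_ij.
have /vlineP[c] : vec (point j) \in line (point i) by rewrite eq_ij memv_line.
have [a <-] := gf4_val_surj cardF w2 c.
rewrite -(frame_vectorZ cardF w2) => /(frame_vector_inj cardF thetaE w2 frame) ji.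
have /all_iotaP/(_ i lti)/all_iotaP/(_ j ltj) := points_not_proportional.
move=> /allP/(_ a (mem_gf4_enum a)).
by rewrite neq_ij ji eqxx.
Qed.

Definition oval_mask : bitseq := [seq line x \in H0 | x <- points].

Lemma nth_oval_mask i : (i < 12)%N ->
  nth false oval_mask i = (line (point i) \in H0).
Proof. by move=> lti; rewrite (nth_map 0). Qed.

Lemma count_oval_mask : (6 <= count id oval_mask)%N.
Proof.
rewrite count_map -size_filter -(size_map (fun x => line x)).
case: (H0_hyperoval) => <- _ _; apply: uniq_leq_size; first exact: fset_uniq.
move=> P HP; have [v v1 Pv] := hyperoval_unit HP.
have [x unit_x xv] := unit_line v1; have [p point_p [xp _]] := point_lineP unit_x.
apply/mapP; exists p; last by rewrite -xp xv.
by rewrite mem_filter point_p andbT /= -xp xv -Pv.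
Qed.

Lemma oval_mask_arc : no_three_collinear oval_mask.
Proof.
apply/allP=> -[[i j] k] /(allP collinear_triplesP)/and3P[/andP[]].
rewrite [(_, k).2]/= [(i, j, k).1]/= [(i, j).1]/= [(i, j).2]/= => ltij ltjk ltk.
case/hasP=> a _ /hasP[b _ /eqP col].
have ltj := ltn_trans ltjk ltk; have lti := ltn_trans ltij ltj.
rewrite !nth_oval_mask //; apply/negP=> /and3P[Hi Hj Hk].
case: (H0_hyperoval) => _ dim1 arc.
have neq (s t : nat) : (s < t)%N -> (t < 12)%N -> line (point s) != line (point t).
  move=> lt_st ltt; apply: contraTneq lt_st => eq_line.
  case: (ltnP s 12) => lts; last by rewrite ltnNge (leq_trans (ltnW ltt)).
  by rewrite (point_line_inj lts ltt eq_line) ltnn.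
have ltik := ltn_trans ltij ltjk.
apply: (arc _ _ _ Hi Hj Hk (neq _ _ ltij ltj) (neq _ _ ltik ltk) (neq _ _ ltjk ltk)).
exists (line (point i) + line (point j))%VS; split; rewrite ?addvSl ?addvSr //.
  apply/eqP; rewrite eqn_leq; apply/andP; split.
    by rewrite (leq_trans (dimv_add_leqif _ _)) // !dim1.
  rewrite ltnNge; apply: contra (neq _ _ ltij ltj) => le1; apply/eqP.
  (* If the sum of the two lines had dimension 1, it would equal both. *)
  have eq_sum P : \dim P = 1%N -> (P <= line (point i) + line (point j))%VS ->
      P = (line (point i) + line (point j))%VS.
    by move=> dimP sP; apply/eqP; rewrite eqEdim sP dimP.
  by rewrite [LHS]eq_sum ?[RHS]eq_sum ?addvSl ?addvSr ?dim1.
rewrite -memvE col (frame_vectorD cardF) !(frame_vectorZ cardF w2).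
by rewrite memv_add ?memvZ ?memv_line.
Qed.

(** The membership list of H0 satisfies the hypotheses of [six_arcs]; the value
    at the point of any unit vector follows by scaling. *)
Lemma oval_two_frames : <[e1]>%VS \in H0 ->
  exists2 k, k \in gf4_units &
    {in unit_triples, forall x, (line x \in H0) = two_frames k x}.
Proof.
move=> He1; have sz : size oval_mask = 12 by rewrite size_map.
have /implyP := all_masksP six_arcs sz.
rewrite nth_oval_mask // count_oval_mask oval_mask_arc.
(* The mask is read at the place of the point (1, 0, 0), spanned by e1. *)
have -> : vec (point (index (gf4_1, 0, 0) points)) = e1.
  by rewrite /frame_vector /= (gf4_val1 w) !(gf4_val0 w) !scale0r !addr0 scale1r.
rewrite He1 => /(_ isT)/hasP[k unit_k /eqP mask_k]; exists k => // x unit_x.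
have [p point_p [-> ->]] := point_lineP unit_x; last by [].
have := congr1 (fun m => nth false m (index p points)) mask_k.
by rewrite !(nth_map 0) ?index_mem // !nth_index.
Qed.

End InFrame.
End Hyperoval.

(** * The switched graph in coordinates *)

Definition model_adj (i j : nat) : bool :=
  let x := nth 0 unit_triples i in let y := nth 0 unit_triples j in
  ((i != j) && (triple_herm x y + triple_herm y x == 0))
    (+) (two_frames gf4_1 x (+) two_frames gf4_1 y).

(** The coincidence on which the proof rests: with the numbering of subalgebras
    given by [A2_words], the switched graph is the graph of subalgebras. *)
Lemma model_adjE : all (fun i => all (fun j =>
  model_adj i j == entry false A2_adjacency i j) (iota 0 36)) (iota 0 36).
Proof. by vm_compute. Qed.

Section Model.
Variables (F : finFieldType) (theta : {rmorphism F -> F}) (V : vectType F).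
Variable h : {hermitian V for false & theta}.
Variable H0 : {fset {vspace V}}.
Hypotheses (cardF : #|F| = 4%N) (thetaE : forall a : F, theta a = a ^+ 2).
Hypotheses (dimV : \dim {:V} = 3%N) (h_nondeg : nondegenerate h).
Hypothesis H0_hyperoval : hyperoval H0.
Hypothesis H0_nonisotropic :
  forall x : V, x != 0 -> <[x]>%VS \in H0 -> h x x != 0.

Lemma exists_adapted_frame (w : F) : w * w = w + 1 ->
  exists e1 e2 e3, orthonormal h [:: e1; e2; e3] /\
    {in unit_triples, forall x,
      (<[frame_vector w e1 e2 e3 x]>%VS \in H0) = two_frames gf4_1 x}.
Proof.
move=> w2.
have [e1 n1 He1] : exists2 e1, h e1 e1 = 1 & <[e1]>%VS \in H0.
  have [P HP] : exists P, P \in H0.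
    by apply/fset0Pn; rewrite -cardfs_gt0; case: H0_hyperoval => ->.
  have [x x1 Px] := hyperoval_unit thetaE H0_hyperoval H0_nonisotropic HP.
  by exists x; rewrite // -Px.
have [e2 [e3 frame]] := exists_orthonormal_frame cardF thetaE h_nondeg n1 dimV.
have [k unit_k H0k] := oval_two_frames cardF thetaE dimV H0_hyperoval
  H0_nonisotropic w2 frame He1.
have /allP/(_ k unit_k)/andP[/eqP norm_k /allP rescale] := two_frames_rescale.
have norm_ke3 : h (gf4_val w k *: e3) (gf4_val w k *: e3) = h e3 e3.
  rewrite linearZl_LR linearZr_LR /= mulrA thetaE (gf4_val_sqr cardF w2).
  by rewrite -(gf4_valM cardF w2) norm_k (gf4_val1 w) mul1r.
exists e1, e2, (gf4_val w k *: e3); split.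
  move: frame; rewrite /orthonormal /ortho_rec /= norm_ke3 !linearZr_LR /=.
  rewrite !mulf_eq0 !andbT.
  by case/andP=> -> /andP[/andP[-> ->] ->]; rewrite !orbT.
move=> x unit_x; have /andP[unit_y /eqP <-] := rescale x unit_x.
rewrite -(H0k _ unit_y); congr (<[_]>%VS \in H0).
by rewrite /frame_vector (gf4_valM cardF w2) scalerA.
Qed.

Lemma switched_graph_isog :
  graph_aut A2_graph \isog
    graph_aut (switch (vectors_over h H0) (@unit_graph F theta V h)).
Proof.
have [w w2] := exists_primitive_card4 cardF.
have [e1 [e2 [e3 [frame H0E]]]] := exists_adapted_frame w2.
pose vec (i : 'I_36) := frame_vector w e1 e2 e3 (nth 0 unit_triples i).
have unit_nth (i : 'I_36) : nth 0 unit_triples i \in unit_triples.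
  by rewrite mem_nth.
have norm1 i : h (vec i) (vec i) == 1.
  rewrite (frame_vector_herm cardF thetaE w2 frame).
  by have := unit_nth i; rewrite mem_unit_triples => /eqP ->; rewrite (gf4_val1 w).
pose f (i : 'I_36) : unit_vector h := exist _ (vec i) (norm1 i).
have f_inj : injective f.
  move=> i j /(congr1 sval)/(frame_vector_inj cardF thetaE w2 frame)/eqP.
  by rewrite nth_uniq // => /eqP/val_inj.
apply: (@graph_aut_isog _ _ _ _ f) => // [[v v1]|i j].
  have [x unit_x xv] := unit_line cardF thetaE dimV w2 frame (eqP v1).
  have ltx : (index x unit_triples < 36)%N by rewrite index_mem.
  by exists (Ordinal ltx); apply: val_inj; rewrite /= /vec nth_index.
rewrite -[LHS]/((f i != f j) && (trace_form h (sval (f i)) (sval (f j)) == 0)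
  (+) ((f i \in vectors_over h H0) (+) (f j \in vectors_over h H0))).
rewrite (inj_eq f_inj) !inE [sval (f i)]/= [sval (f j)]/= /vec !H0E //.
have /all_iotaP/(_ i (ltn_ord i))/all_iotaP := model_adjE.
move=> /(_ j (ltn_ord j))/eqP; rewrite /A2_graph => <-.
rewrite /model_adj; congr ((_ && _) (+) _).
rewrite /trace_form !(frame_vector_herm cardF thetaE w2 frame) -(gf4_valD cardF).
by rewrite -(gf4_val0 w) (inj_eq (gf4_val_inj cardF w2)).
Qed.

End Model.

Theorem lemma4p4 (F : finFieldType) (theta : {rmorphism F -> F})
    (V : vectType F) (h : {hermitian V for false & theta})
    (H0 : {fset {vspace V}})
    (cardF : #|F| = 4%N) (thetaE : forall a : F, theta a = a ^+ 2)
    (dimV : \dim {:V} = 3%N) (h_nondeg : nondegenerate h)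
    (H0_hyperoval : hyperoval H0)
    (H0_nonisotropic :
       forall x : V, x != 0 -> <[x]>%VS \in H0 -> h x x != 0) :
  graph_aut (switch (vectors_over h H0) (@unit_graph F theta V h))
    \isog chevalley_G2 'F_2.
Proof.
apply: isog_trans graph_aut_A2_isog; rewrite isog_sym.
exact: switched_graph_isog.
Qed.
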